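(* Let $q$ be a power of a prime $p$ and let $r\ge1$ be an integer satisfying one of: (1) $r=p^v-1$; (2) $(r+1)\mid(q-1)$; (3) $r+1=up^v$ for positive integers $u,v$. Let $E/\mathbb{F}_q$ be a rational function field, $\mathcal{G}\subseteq\mathrm{Aut}(E/\mathbb{F}_q)$ a subgroup of order $r+1$, $F=E^{\mathcal{G}}$ its fixed field. Let $P_\infty$ be the place at infinity of $E$, $Q_\infty$ the place of $F$ under $P_\infty$, and $z\in E$ with $(z)_\infty=P_\infty$. Let $2\le s\le\frac{q+1-2r}{r+1}$, and let $Q_1,\dots,Q_s$ be distinct rational places of $F$, different from $Q_\infty$, splitting completely in $E/F$, with $P_{i,1},\dots,P_{i,r+1}$ the places of $E$ over $Q_i$. Let $1\le t\le s$ and let $f_1,\dots,f_t$ be a basis of $\mathcal{L}((t-1)Q_\infty)$ (in $F$). For $\mathbf a=(a_{i,j})_{0\le i\le r-1,1\le j\le t}\in\mathbb{F}_q^{rt}$ let $f_{\mathbf a}=\sum_{i=0}^{r-1}\sum_{j=1}^ta_{i,j}f_jz^i$ and define $$C_e=\Big\{\Big(f_{\mathbf a}(P_{1,1}),\dots,f_{\mathbf a}(P_{s,r+1}),\ \sum_{j=1}^t a_{r-1,j}f_j(Q_1),\dots,\sum_{j=1}^ta_{r-1,j}f_j(Q_s)\Big):\mathbf a\in\mathbb{F}_q^{rt}\Big\}.$$ Then $C_e$ is an $\mathbb{F}_q$-linear $(r,3)$-LRC of length $n=s(r+2)$ and dimension $k=rt$. Moreover, if $t=s$, then $C_e$ is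 optimal, i.e. its minimum distance equals $n-k-(\lceil k/r\rceil-1)\cdot 2+1=n-rt-2t+3$.
   Context: For integers $r\ge1,\delta\ge2$, a linear code $C\subseteq\mathbb{F}_q^n$ is an $(r,\delta)$-LRC if for every coordinate $i$ there is a set $I_i\ni i$ with $|I_i|\le r+\delta-1$ such that the restriction (puncturing) of $C$ to the coordinates in $I_i$ has minimum distance at least $\delta$. An $[n,k,d]$ $(r,\delta)$-LRC satisfies $d\le n-k-(\lceil k/r\rceil-1)(\delta-1)+1$ and is called optimal if equality holds. $\mathcal{L}(G)$ denotes the Riemann–Roch space of a divisor $G$; a function $f\in F$ regular at $Q_i$ satisfies $f(P_{i,h})=f(Q_i)$. *)

(* Defs.v *)
From HB Require Import structures.
From mathcomp Require Import all_boot all_order all_algebra.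
From Stdlib Require Import ClassicalEpsilon.
Set Implicit Arguments. Unset Strict Implicit. Unset Printing Implicit Defensive.
Import Order.TTheory GRing.Theory Num.Theory.
Local Open Scope ring_scope.

Section RFF.
Variable K : finFieldType.

Definition RFF := {fraction {poly K}}.
Definition tof (g : {poly K}) : RFF := FracField.tofrac g.
Definition cst (c : K) : RFF := tof c%:P.
Definition xE : RFF := tof 'X.

(* places of K(x): P_pi for pi monic irreducible, and the infinite place
   (pole of x) *)
Inductive place := PFin of {poly K} | PInf.

Definition is_place (R : place) : Prop :=
  match R with
  | PFin pi => pi \is monic /\ irreducible_poly pi
  | PInf => True
  end.

Definition rational_place (R : place) : Prop :=
  R = PInf \/ exists a : K, R = PFin ('X - a%:P).

(* vge R m f  <->  v_R(f) >= m   (with v_R(0) = +oo) *)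
Definition vge (R : place) (m : int) (f : RFF) : Prop :=
  match R with
  | PFin pi => f = 0 \/ exists g h : {poly K},
      ~~ (pi %| h) /\ f * (tof pi) ^ (- m) = tof g / tof h
  | PInf => f = 0 \/ exists g h : {poly K},
      h != 0 /\ f = tof g / tof h /\ ((size g)%:Z + m <= (size h)%:Z)
  end.

Definition veq (R : place) (m : int) (f : RFF) : Prop :=
  vge R m f /\ ~ vge R (m + 1) f.

Definition ev (R : place) (f : RFF) : K :=
  epsilon (inhabits 0) (fun c : K => vge R 1 (f - cst c)).

Definition is_aut (sigma : RFF -> RFF) : Prop :=
  (forall x y, sigma (x + y) = sigma x + sigma y) /\
  (forall x y, sigma (x * y) = sigma x * sigma y) /\
  sigma 1 = 1 /\ bijective sigma /\ (forall c, sigma (cst c) = cst c).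

Definition is_aut_subgroup N (G : 'I_N -> RFF -> RFF) : Prop :=
  (forall i, is_aut (G i)) /\
  (forall i j, i != j -> exists f, G i f <> G j f) /\
  (exists i, forall f, G i f = f) /\
  (forall i j, exists k, forall f, G k f = G i (G j f)) /\
  (forall i, exists k, forall f, G k (G i f) = f).

Definition inF N (G : 'I_N -> RFF -> RFF) (f : RFF) : Prop :=
  forall i, G i f = f.

(* R and R' lie over the same place of F: O_R /\ F = O_R' /\ F *)
Definition same_below N (G : 'I_N -> RFF -> RFF) (R R' : place) : Prop :=
  forall g, inF G g -> (vge R 0 g <-> vge R' 0 g).

Definition is_ramidx N (G : 'I_N -> RFF -> RFF) (R : place) (e : nat) : Prop :=
  (0 < e)%N /\ (exists u, inF G u /\ veq R e%:Z u) /\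
  (forall u m, inF G u -> veq R m u -> (e%:Z %| m)%Z).

(* for g in F: v_Q(g) >= m, where Q is the place of F below R *)
Definition vgeQ N (G : 'I_N -> RFF -> RFF) (R : place) (m : int) (g : RFF) : Prop :=
  exists e : nat, is_ramidx G R e /\ vge R (m * e%:Z) g.

Definition rational_below N (G : 'I_N -> RFF -> RFF) (R : place) : Prop :=
  forall g, inF G g -> vge R 0 g -> exists c : K, vge R 1 (g - cst c).

Definition inL N (G : 'I_N -> RFF -> RFF) (m : nat) (g : RFF) : Prop :=
  inF G g /\
  (forall R, is_place R -> ~ same_below G R PInf -> vge R 0 g) /\
  vgeQ G PInf (- (m%:Z)) g.

End RFF.
Arguments PInf {K}.

Section Codes.
Variable K : finFieldType.
Variable n : nat.

Definition wt (x : 'rV[K]_n) : nat := #|[set i | x ord0 i != 0%R]|.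

Definition is_lincode (C : {set 'rV[K]_n}) : Prop :=
  0 \in C /\ (forall x y c, x \in C -> y \in C -> c *: x + y \in C).

Definition code_dim (C : {set 'rV[K]_n}) : nat := \dim <<enum C>>%VS.

Definition min_dist (C : {set 'rV[K]_n}) (d : nat) : Prop :=
  (exists2 c, c \in C & c != 0 /\ wt c = d) /\
  (forall c, c \in C -> c != 0 -> (d <= wt c)%N).

Definition punct_dist_ge (C : {set 'rV[K]_n}) (I : {set 'I_n}) (delta : nat) : Prop :=
  forall c, c \in C -> [exists i in I, c ord0 i != 0%R] ->
    (delta <= #|[set i in I | c ord0 i != 0%R]|)%N.

Definition is_LRC (C : {set 'rV[K]_n}) (r delta : nat) : Prop :=
  forall i : 'I_n, exists I : {set 'I_n},
    i \in I /\ (#|I| <= r + delta - 1)%N /\ punct_dist_ge C I delta.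

Definition optimal_bound (k r delta : nat) : nat :=
  n - k - ((k + r - 1) %/ r - 1) * (delta - 1) + 1.

End Codes.

Section Ce.
Variables (K : finFieldType) (r s t : nat).
Variables (z : RFF K) (f : nat -> RFF K) (P : nat -> nat -> place K).

(* a_{r-1,j} (rows of A indexed 0..r-1) *)
Definition lastrow (A : 'M[K]_(r, t)) (j : 'I_t) : K :=
  \sum_(i < r | (i : nat) == r.-1) A i j.

Definition fa (A : 'M[K]_(r, t)) : RFF K :=
  \sum_(i < r) \sum_(j < t) cst (A i j) * f j * z ^+ i.

(* coordinates: P_{0,0},...,P_{0,r},P_{1,0},...,P_{s-1,r}, then Q_0..Q_{s-1};
   the place Q_i of F is represented by P_{i,0} lying above it *)
Definition enc (A : 'M[K]_(r, t)) (k : nat) : K :=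
  if (k < s * r.+1)%N then ev (P (k %/ r.+1) (k %% r.+1)) (fa A)
  else \sum_(j < t) lastrow A j * ev (P (k - s * r.+1) 0%N) (f j).

Definition Ce : {set 'rV[K]_(s * (r + 2))} :=
  [set \row_(k < s * (r + 2)) enc A k | A : 'M[K]_(r, t)].

End Ce.

(* Main.v *)
Require Import Defs.
From HB Require Import structures.
From mathcomp Require Import all_boot all_order all_algebra.
From Stdlib Require Import Classical ClassicalEpsilon.
Import Order.TTheory GRing.Theory Num.Theory.
From mathcomp Require Import zify.
Local Open Scope ring_scope.

(* On the r + 1 places above Q_i the functions f_j are constant, so a codeword
   restricts there to the values, at r + 1 distinct points z(P_{i,h}), of a
   polynomial g_i of degree < r; with the extra symbol, its coefficient of
   degree r - 1, each block is a doubly extended Reed-Solomon code [r + 2, r, 3].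
   The code is thus the image of the a_{l,j} under the matrix (f_j(Q_i)),
   followed by s copies of this block code, and everything reduces to: a function
   g in L((t - 1) Q_oo) vanishing at Q_1, ..., Q_s with t <= s is 0.

   No place theory of E/F is needed for this. Every element of G sends x to a
   Moebius transform of x, so u = N(x - c) = U / V lies in F, has deg U <= r + 1
   and, for suitable c, a pole at infinity. For m = t - 1 the function g u^-m of F
   is regular at P_oo, hence at every place above Q_oo; therefore g V^m is a
   polynomial of degree at most m (r + 1) < s (r + 1) with s (r + 1) roots. *)

(** * Rational functions and their values *)

Lemma monic_irreducible_factor (K : fieldType) (p : {poly K}) :
  (1 < size p)%N ->
  exists pi : {poly K}, [/\ pi \is monic, irreducible_poly pi & pi %| p].
Proof.
have [n] := ubnP (size p); elim: n p => // n IHn p lt_p_n p_gt1.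
have p_neq0 : p != 0 by rewrite -size_poly_gt0 ltnW.
have [irr_p | red_p] := classic (irreducible_poly p).
  have lc_neq0 : (lead_coef p)^-1 != 0 by rewrite invr_eq0 lead_coef_eq0.
  exists ((lead_coef p)^-1 *: p); split.
  - by rewrite monicE lead_coefZ mulVf ?lead_coef_eq0.
  - split=> [|d d_neq1]; rewrite ?size_scale // dvdpZr // => d_dvd.
    by rewrite (eqp_rtrans (eqp_scale _ lc_neq0)) irr_p.
  - by rewrite dvdpZl.
have [d [d_neq1 d_dvd d_neqp]] :
    exists d : {poly K}, [/\ size d != 1%N, d %| p & ~~ (d %= p)].
  apply: NNPP => no_d; apply: red_p; split=> // d d_neq1 d_dvd.
  by apply: contraT => d_neqp; case: no_d; exists d.
have d_neq0 : d != 0 by apply: contraNneq p_neq0 => d0; rewrite d0 dvd0p in d_dvd.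
have lt_d_p : (size d < size p)%N.
  by rewrite ltn_neqAle (dvdp_leq p_neq0 d_dvd) andbT dvdp_size_eqp.
have d_gt1 : (1 < size d)%N.
  by rewrite ltn_neqAle eq_sym d_neq1 size_poly_gt0.
have [pi [pi_monic pi_irr pi_dvd]] := IHn d (leq_trans lt_d_p lt_p_n) d_gt1.
by exists pi; split=> //; apply: dvdp_trans d_dvd.
Qed.

HB.instance Definition _ (K : finFieldType) :=
  GRing.RMorphism.copy (@tof K) (@FracField.tofrac {poly K}).

Section RationalFunctions.
Variable K : finFieldType.
Implicit Types (g h : {poly K}) (u v : RFF K) (R : place K) (a b : K).

Lemma tof_inj : injective (@tof K).
Proof. by move=> g h /eqP; rewrite /tof tofrac_eq => /eqP. Qed.

Lemma tof_eq0 g : (tof g == 0) = (g == 0).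
Proof. exact: tofrac_eq0. Qed.

Lemma tof_neq0 g : g != 0 -> tof g != 0.
Proof. by rewrite tof_eq0. Qed.

Lemma RFF_fractionP u :
  exists g h, [/\ h != 0, coprimep g h & u = tof g / tof h].
Proof.
have [g [h [h_neq0 ->]]] : exists g h, h != 0 /\ u = tof g / tof h.
  elim/quotW: u => x; exists \n_x, \d_x.
  have dx_neq0 := denom_ratioP x; split=> //.
  apply: (canRL (mulfK (tof_neq0 _ dx_neq0))).
  rewrite /tof; apply/eqP; rewrite !piE /FracField.equivf /FracField.mulf.
  by rewrite !numden_Ratio ?mulf_neq0 ?oner_eq0 // !mulr1 mulrC.
pose d := gcdp g h; have d_neq0 : d != 0 by rewrite gcdp_eq0 (negPf h_neq0) andbF.
have [gE hE] : g = g %/ d * d /\ h = h %/ d * d.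
  by rewrite !divpK ?dvdp_gcdl ?dvdp_gcdr.
exists (g %/ d), (h %/ d); split.
- by apply: contraNneq h_neq0 => h0; rewrite hE h0 mul0r.
- by rewrite coprimep_div_gcd ?h_neq0 ?orbT.
by rewrite {1}gE {1}hE !rmorphM /= -mulf_div divff ?mulr1 ?tof_neq0.
Qed.

Lemma tof_div_eq g1 h1 g2 h2 : h1 != 0 -> h2 != 0 ->
  tof g1 / tof h1 = tof g2 / tof h2 -> g1 * h2 = g2 * h1.
Proof.
move=> h1_neq0 h2_neq0 /eqP; rewrite eqr_div ?tof_neq0 // -!rmorphM.
by move/eqP/tof_inj.
Qed.

Lemma vge_PFin0 pi u : vge (PFin pi) 0 u ->
  u = 0 \/ exists g h, ~~ (pi %| h) /\ u = tof g / tof h.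
Proof.
by case=> [|[g [h [pi_h]]]]; [left | rewrite oppr0 expr0z mulr1; right; exists g, h].
Qed.

(** In lowest terms, an irreducible factor of the denominator would be a finite pole. *)
Lemma regular_is_poly u :
  (forall R, is_place R -> R <> PInf -> vge R 0 u) -> exists g, u = tof g.
Proof.
move=> u_reg; have [g [h [h_neq0 cop_gh uE]]] := RFF_fractionP u.
have [h_gt1 | h_le1] := ltnP 1 (size h); last first.
  have [c c_neq0 hE] : exists2 c : K, c != 0 & h = c%:P.
    by apply/size_poly1P; rewrite eqn_leq h_le1 size_poly_gt0.
  exists (c^-1 *: g); rewrite uE hE.
  apply: (canLR (mulfK _)); first by rewrite tof_neq0 ?polyC_eq0.
  by rewrite -rmorphM -mul_polyC mulrAC -polyCM mulVf // polyC1 mul1r.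
have [pi [pi_monic pi_irr pi_h]] := monic_irreducible_factor _ h h_gt1.
have u_reg_pi : vge (PFin pi) 0 u by apply: u_reg.
have [u0 | [g' [h' [pi_h' uE']]]] := vge_PFin0 _ _ u_reg_pi.
  by exists 0; rewrite rmorph0.
have h'_neq0 : h' != 0 by apply: contraNneq pi_h' => ->; rewrite dvdp0.
rewrite uE in uE'; have := tof_div_eq _ _ _ _ h_neq0 h'_neq0 uE'.
have pi_g : ~~ (pi %| g).
  apply/negP=> pi_g; have := pi_irr.1.
  have := dvdp_gcd pi g h; rewrite pi_g pi_h => /dvdp_size_eqp.
  have: pi %| gcdp g h by rewrite dvdp_gcd pi_g.
  rewrite /coprimep in cop_gh; have gcd_neq0 : gcdp g h != 0.
    by rewrite -size_poly_gt0 (eqP cop_gh).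
  by move/(dvdp_leq gcd_neq0); rewrite (eqP cop_gh) leqNgt => /negP.
move=> ghE; have : pi %| g * h' by rewrite ghE dvdp_mull.
by rewrite Gauss_dvdpl ?irreducible_poly_coprime // (negPf pi_g).
Qed.

(** Evaluation at [x = a] as a relation: it carries regularity with it and passes through ring
    operations, whereas [ev] is only a choice of constant. *)
Definition has_value a u b :=
  exists g h, [/\ h.[a] != 0, u = tof g / tof h & b = g.[a] / h.[a]].

Lemma nzero_horner h a : h.[a] != 0 -> h != 0.
Proof. by apply: contraNneq => ->; rewrite horner0. Qed.

Lemma has_value_tof a g : has_value a (tof g) g.[a].
Proof.
by exists g, 1; rewrite hornerC rmorph1 !divr1; split; rewrite ?oner_eq0.
Qed.

Lemma has_value_cst a b : has_value a (cst b) b.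
Proof. by have := has_value_tof a b%:P; rewrite hornerC. Qed.

Lemma has_value_add a u v b c :
  has_value a u b -> has_value a v c -> has_value a (u + v) (b + c).
Proof.
move=> [g1 [h1 [h1a -> ->]]] [g2 [h2 [h2a -> ->]]].
exists (g1 * h2 + g2 * h1), (h1 * h2).
rewrite !hornerE mulf_neq0 // !addf_div //; last 2 first.
- by rewrite tof_neq0 // (nzero_horner _ a).
- by rewrite tof_neq0 // (nzero_horner _ a).
by rewrite rmorphD !rmorphM.
Qed.

Lemma has_value_mul a u v b c :
  has_value a u b -> has_value a v c -> has_value a (u * v) (b * c).
Proof.
move=> [g1 [h1 [h1a -> ->]]] [g2 [h2 [h2a -> ->]]].
exists (g1 * g2), (h1 * h2).
by rewrite !hornerM mulf_neq0 // !mulf_div -!rmorphM.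
Qed.

Lemma has_value_exp a u b n : has_value a u b -> has_value a (u ^+ n) (b ^+ n).
Proof.
move=> ub; elim: n => [|n IHn]; last by rewrite !exprS; apply: has_value_mul.
by rewrite !expr0 -[X in has_value _ X](rmorph1 (@tof K)) -polyC1; apply: has_value_cst.
Qed.

Lemma has_value_sum a (I : finType) (F : I -> RFF K) (c : I -> K) :
  (forall i, has_value a (F i) (c i)) ->
  has_value a (\sum_i F i) (\sum_i c i).
Proof.
move=> Fc; elim/big_ind2: _ => //; last by move=> *; apply: has_value_add.
by rewrite -[X in has_value _ X](rmorph0 (@tof K)) -polyC0; apply: has_value_cst.
Qed.

Lemma has_value_inj a u b c : has_value a u b -> has_value a u c -> b = c.
Proof.
move=> [g1 [h1 [h1a -> ->]]] [g2 [h2 [h2a e ->]]].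
have := tof_div_eq _ _ _ _ (nzero_horner _ _ h1a) (nzero_horner _ _ h2a) e.
by move/(congr1 (horner^~ a)); rewrite !hornerE => E; apply/eqP; rewrite eqr_div ?E.
Qed.

Lemma has_value_inv a u b : b != 0 -> has_value a u b -> has_value a u^-1 b^-1.
Proof.
move=> b_neq0 [g [h [ha -> bE]]]; rewrite bE mulf_eq0 invr_eq0 (negPf ha) orbF in b_neq0.
by exists h, g; rewrite bE !invf_div.
Qed.

Lemma XsubC_ndvd a h : ~~ ('X - a%:P %| h) = (h.[a] != 0).
Proof. by rewrite dvdp_XsubCl rootE. Qed.

Lemma has_value_vge0 a u b : has_value a u b -> vge (PFin ('X - a%:P)) 0 u.
Proof.
move=> [g [h [ha -> _]]]; right; exists g, h.
by rewrite XsubC_ndvd ha oppr0 expr0z mulr1.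
Qed.

Lemma vge0_has_value a u :
  vge (PFin ('X - a%:P)) 0 u -> exists b, has_value a u b.
Proof.
move=> /vge_PFin0[-> | [g [h [ha ->]]]].
  by exists 0; rewrite -[X in has_value _ X](rmorph0 (@tof K)) -polyC0; apply: has_value_cst.
by exists (g.[a] / h.[a]), g, h; rewrite -XsubC_ndvd.
Qed.

Lemma vge1_has_value0 a u : vge (PFin ('X - a%:P)) 1 u <-> has_value a u 0.
Proof.
have pi_neq0 : tof ('X - a%:P) != 0 :> RFF K by rewrite tof_neq0 ?polyXsubC_eq0.
split=> [[-> | [g [h [ha uE]]]] | [g [h [ha uE]]]].
- by rewrite -[X in has_value _ X](rmorph0 (@tof K)) -polyC0; apply: has_value_cst.
- exists (g * ('X - a%:P)), h; rewrite -XsubC_ndvd ha !hornerE subrr mulr0 mul0r.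
  split=> //; rewrite rmorphM mulrAC -uE /= -mulrA.
  by rewrite exprN1 mulVf ?mulr1.
- move=> /esym/eqP; rewrite mulf_eq0 invr_eq0 (negPf ha) orbF => /factor_theorem[g' gE].
  right; exists g', h; rewrite XsubC_ndvd ha; split=> //.
  by rewrite uE gE rmorphM exprN1 mulrAC mulfK.
Qed.

(** The value [b] shows that [epsilon] has a constant to choose, and uniqueness of values identifies
    the chosen one with [b]. *)
Lemma ev_has_value a u b : has_value a u b -> ev (PFin ('X - a%:P)) u = b.
Proof.
move=> ub; have has_value_sub c d : has_value a u d -> has_value a (u - cst c) (d - c).
  move=> ud; apply: has_value_add => //; rewrite /cst -rmorphN -polyCN.
  exact: has_value_cst.
have /vge1_has_value0 e0 :
    vge (PFin ('X - a%:P)) 1 (u - cst (ev (PFin ('X - a%:P)) u)).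
  apply: (epsilon_spec _ (fun c => vge _ 1 (u - cst c))).
  by exists b; apply/vge1_has_value0; rewrite -(subrr b); apply: has_value_sub.
apply/esym/eqP; rewrite -subr_eq0.
by rewrite (has_value_inj a _ _ _ (has_value_sub _ _ ub) e0).
Qed.

(** [vge] at infinity asks for some representation as a fraction; cross multiplication shows that
    the degree difference is the same for all of them. *)
Lemma vgeInf_tof_div m g h : h != 0 -> vge PInf m (tof g / tof h) ->
  g = 0 \/ (size g)%:Z + m <= (size h)%:Z.
Proof.
move=> h_neq0 [/eqP|[g' [h' [h'_neq0 [e szE]]]]].
  by rewrite mulf_eq0 invr_eq0 !tof_eq0 (negPf h_neq0) orbF => /eqP; left.
have [-> | g_neq0] := eqVneq g 0; [by left | right].
have E := tof_div_eq _ _ _ _ h_neq0 h'_neq0 e.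
have g'_neq0 : g' != 0.
  by apply: contraNneq g_neq0 => g'0; move/eqP: E; rewrite g'0 mul0r mulf_eq0 (negPf h'_neq0) orbF.
have := congr1 (fun p : {poly K} => size p) E; rewrite !size_mul //.
have := size_poly_gt0 g; have := size_poly_gt0 g'; rewrite g_neq0 g'_neq0.
have := size_poly_gt0 h; have := size_poly_gt0 h'; rewrite h_neq0 h'_neq0.
move: szE.
move: (size g) (size g') (size h) (size h') => a b c d; lia.
Qed.

(** Without finite poles [z] is a polynomial, and a simple pole at infinity gives it degree 1; so
    [z] will separate the finite rational places. *)
Lemma linear_of_pole_divisor (z : RFF K) : veq PInf (-1) z ->
  (forall R, is_place R -> R <> PInf -> vge R 0 z) ->
  exists g, z = tof g /\ size g = 2.
Proof.
move=> [z_ge z_nge] /regular_is_poly[g zE]; exists g; split=> //.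
rewrite zE -[tof g]divr1 -(rmorph1 (@tof K)) in z_ge z_nge.
have sz1 := size_poly1 K.
have sz_g : (1 < size g)%N.
  rewrite ltnNge; apply/negP=> sz_g; apply: z_nge; rewrite addNr; right.
  by exists g, 1; split; rewrite ?oner_eq0 //; split=> //; rewrite sz1; lia.
case: (vgeInf_tof_div _ _ _ _ z_ge) => [|g0|]; rewrite ?oner_eq0 ?sz1 //; last lia.
by rewrite g0 size_poly0 in sz_g.
Qed.

End RationalFunctions.

(** * Automorphisms and the fixed field *)

(* Dehomogenized, this is the rational root theorem for the point (u : v). *)
Lemma dvdp_homogeneous_root (K : fieldType) n (c : 'I_n -> {poly K})
    (u v : {poly K}) :
  coprimep u v -> u != 0 -> (exists k, c k != 0) ->
  \sum_(k < n) c k * u ^+ k * v ^+ (n - k.+1) = 0 ->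
  exists k, c k != 0 /\ u %| c k.
Proof.
move=> cop_uv u_neq0 [k1 ck1] sum0.
(* For the least [k] with [c k] nonzero, all other terms of the sum are divisible by [u ^+ k.+1],
   hence so is the term at [k]. *)
have [k ck_neq0 k_min] := @arg_minnP _ k1 (fun k => c k != 0) val ck1.
exists k; split=> //.
have dvd_k : u ^+ k.+1 %| c k * u ^+ k * v ^+ (n - k.+1).
  move/eqP: sum0; rewrite (bigD1 k) //= addr_eq0 => /eqP->; rewrite dvdpNr.
  apply: (big_ind (fun p => u ^+ k.+1 %| p)) => [|p q|l l_neq_k];
    [exact: dvdp0 | exact: dvdp_add | ].
  have [->|cl_neq0] := eqVneq (c l) 0; first by rewrite !mul0r dvdp0.
  have lt_kl : (k < l)%N by rewrite ltn_neqAle eq_sym l_neq_k k_min.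
  by rewrite dvdp_mulr // dvdp_mull // dvdp_exp2l.
have cop_uvn : coprimep u (v ^+ (n - k.+1)) by rewrite coprimep_expr.
move: dvd_k; rewrite exprS mulrAC dvdp_mul2r ?expf_neq0 //.
by rewrite Gauss_dvdpl.
Qed.

Section Automorphisms.
Variable K : finFieldType.
Implicit Types (p : {poly K}) (sigma : RFF K -> RFF K).

Lemma is_aut_rmorphism sigma : is_aut sigma ->
  exists s : {rmorphism {fraction {poly K}} -> {fraction {poly K}}}, sigma =1 s.
Proof.
move=> [sD [sM [s1 _]]].
have s0 : sigma 0 = 0 by apply: (addrI (sigma 0)); rewrite -sD !addr0.
have sB : zmod_morphism (sigma : {fraction {poly K}} -> {fraction {poly K}}).
  move=> x y; apply: (addIr (sigma y)).
  by rewrite -[sigma x - _ + _]addrA addNr addr0 -sD subrK.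
have sMon : monoid_morphism (sigma : {fraction {poly K}} -> {fraction {poly K}}).
  by split.
pose s : {rmorphism {fraction {poly K}} -> {fraction {poly K}}} :=
  HB.pack sigma (GRing.isZmodMorphism.Build _ _ sigma sB)
    (GRing.isMonoidMorphism.Build _ _ sigma sMon).
by exists s.
Qed.

(** The length [n] is left free so that two polynomials can be expanded over one common range. *)
Lemma is_aut_tof sigma p n : is_aut sigma -> (size p <= n)%N ->
  sigma (tof p) = \sum_(k < n) cst p`_k * sigma (xE K) ^+ k.
Proof.
move=> s_aut p_n; have [s sE] := is_aut_rmorphism _ s_aut.
have s_cst c : s (cst c) = cst c by rewrite -sE s_aut.2.2.2.2.
have -> : tof p = \sum_(k < n) cst p`_k * xE K ^+ k.
  have {1}-> : p = \sum_(k < n) p`_k *: 'X^k.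
    rewrite -(poly_def n (fun k => p`_k)); apply/polyP=> k; rewrite coef_poly.
    by case: ltnP => // n_k; rewrite nth_default // (leq_trans p_n).
  rewrite rmorph_sum; apply: eq_bigr => k _.
  by rewrite -mul_polyC rmorphM rmorphXn.
rewrite !sE rmorph_sum; apply: eq_bigr => k _.
by rewrite rmorphM rmorphXn /= s_cst.
Qed.

(* If sigma y = x with y = a / b, then w := sigma x satisfies a(w) - x b(w) = 0,
   so the numerator and the denominator of w each divide some nonzero
   coefficient a_k - x b_k, which has degree at most 1. *)
Lemma is_aut_moebius sigma : is_aut sigma ->
  exists u v : {poly K}, [/\ v != 0, (size u <= 2)%N, (size v <= 2)%N &
    sigma (xE K) = tof u / tof v].
Proof.
move=> s_aut; have [s sE] := is_aut_rmorphism _ s_aut.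
have [sinv sinvK sinvKr] := s_aut.2.2.2.1.
have [u [v [v_neq0 cop_uv wE]]] := RFF_fractionP _ (sigma (xE K)).
have x_neq0 : xE K != 0 by rewrite /xE tof_neq0 ?polyX_eq0.
have u_neq0 : u != 0.
  apply: contraNneq x_neq0 => u0; apply/eqP/(can_inj sinvK).
  by rewrite wE u0 rmorph0 mul0r sE rmorph0.
exists u, v.
have [a [b [b_neq0 _ abE]]] := RFF_fractionP _ (sinv (xE K)).
pose n := maxn (size a) (size b).
have eqn_w : \sum_(k < n) (cst a`_k - xE K * cst b`_k) * sigma (xE K) ^+ k = 0.
  have : sigma (tof a) = xE K * sigma (tof b).
    rewrite -{1}(sinvKr (xE K)) abE !sE -rmorphM /=.
    by rewrite divfK ?tof_neq0.
  rewrite (is_aut_tof _ _ n) ?leq_maxl // (is_aut_tof _ b n) ?leq_maxr // => e.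
  under eq_bigr => k _ do rewrite mulrBl -mulrA.
  by rewrite sumrB e mulr_sumr subrr.
pose c (k : 'I_n) : {poly K} := (a`_k)%:P - 'X * (b`_k)%:P.
have size_c k : (size (c k) <= 2)%N.
  rewrite (leq_trans (size_polyD _ _)) // geq_max size_polyN.
  rewrite (leq_trans (size_polyC_leq1 _)) // (leq_trans (size_polyMleq _ _)) //.
  by rewrite size_polyX /= ltnS size_polyC_leq1.
(* At the index deg b, the coefficient of ['X] is minus the leading coefficient of [b]. *)
have c_neq0 : exists k, c k != 0.
  have lt_n : ((size b).-1 < n)%N.
    by rewrite (leq_trans _ (leq_maxr _ _)) // prednK ?size_poly_gt0.
  exists (Ordinal lt_n); apply: contraNneq b_neq0 => /polyP/(_ 1%N).
  rewrite coefB coefC /= coefXM /= coefC /= coef0 sub0r => /eqP.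
  by rewrite oppr_eq0 -lead_coef_eq0.
have hom_c : \sum_(k < n) c k * u ^+ k * v ^+ (n - k.+1) = 0.
  apply: tof_inj; rewrite rmorph0 rmorph_sum.
  (* The factor [v ^+ n.-1] clears the denominators of all powers of [u / v] in the equation. *)
  transitivity (tof (v ^+ n.-1) *
      \sum_(k < n) (cst a`_k - xE K * cst b`_k) * sigma (xE K) ^+ k); last first.
    by rewrite eqn_w mulr0.
  rewrite mulr_sumr; apply: eq_bigr => k _; rewrite !(rmorphM, rmorphXn) /=.
  have -> : tof (c k) = cst a`_k - xE K * cst b`_k by rewrite rmorphB rmorphM.
  have -> : n.-1 = (k + (n - k.+1))%N by have := ltn_ord k; lia.
  have vk_neq0 : tof v ^+ k != 0 by rewrite expf_neq0 ?tof_neq0.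
  rewrite wE exprD exprMn exprVn [RHS]mulrCA -!mulrA; congr (_ * _).
  by rewrite [RHS]mulrC !mulrA mulfVK // mulrC.
split=> //.
  have [k [ck_neq0 dvd_k]] := dvdp_homogeneous_root _ _ _ _ _ cop_uv u_neq0 c_neq0 hom_c.
  exact: leq_trans (dvdp_leq ck_neq0 dvd_k) (size_c k).
have [k1 ck1] := c_neq0.
(* Reversing the order of the coefficients exchanges the roles of [u] and [v]. *)
have c'_neq0 : exists k, c (rev_ord k) != 0 by exists (rev_ord k1); rewrite rev_ordK.
have hom_c' : \sum_(k < n) c (rev_ord k) * v ^+ k * u ^+ (n - k.+1) = 0.
  rewrite -{}[RHS]hom_c (reindex_inj rev_ord_inj) /=; apply: eq_bigr => k _.
  by rewrite rev_ordK mulrAC subnSK // subKn // ltnW.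
have cop_vu : coprimep v u by rewrite coprimep_sym.
have [k [ck_neq0 dvd_k]] := dvdp_homogeneous_root _ _ _ _ _ cop_vu v_neq0 c'_neq0 hom_c'.
exact: leq_trans (dvdp_leq ck_neq0 dvd_k) (size_c _).
Qed.

End Automorphisms.

(** * The fixed field F and the spaces L(m Q_oo) *)

Section FixedField.
Variables (K : finFieldType) (N : nat) (G : 'I_N -> RFF K -> RFF K).
Hypothesis HG : is_aut_subgroup G.
Implicit Types (g h : RFF K) (R : place K).

Lemma inF_mul g h : inF G g -> inF G h -> inF G (g * h).
Proof. by move=> Fg Fh i; rewrite (HG.1 i).2.1 Fg Fh. Qed.

Lemma inF_exp g n : inF G g -> inF G (g ^+ n).
Proof.
move=> Fg; elim: n => [|n IHn]; last by rewrite exprS; apply: inF_mul.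
by move=> i; rewrite expr0 (HG.1 i).2.2.1.
Qed.

Lemma inF_inv g : inF G g -> inF G g^-1.
Proof.
move=> Fg i; have [s sE] := is_aut_rmorphism _ _ (HG.1 i).
by rewrite sE fmorphV -sE Fg.
Qed.

Lemma inF_sub_cst g c : inF G g -> inF G (g - cst c).
Proof.
move=> Fg i; have [s sE] := is_aut_rmorphism _ _ (HG.1 i).
by rewrite sE rmorphB /= -!sE Fg (HG.1 i).2.2.2.2.
Qed.

(** Left multiplication by a group element permutes the factors. *)
Lemma inF_orbit_prod g : inF G (\prod_i G i g).
Proof.
have [_ [G_inj [_ [G_mul G_inv]]]] := HG; move=> k.
have [s sE] := is_aut_rmorphism _ _ (HG.1 k); rewrite sE rmorph_prod /=.
have [tau tauE] := fin_all_exists (G_mul k).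
have tau_inj : injective tau.
  move=> i j tau_ij; apply/eqP; apply: contraT => /G_inj[f []].
  have [l Gl] := G_inv k.
  by rewrite -[G i f]Gl -[G j f]Gl -!tauE tau_ij.
rewrite [RHS](reindex_inj tau_inj); apply: eq_bigr => i _.
by rewrite -sE tauE.
Qed.

(* The norm of x - c, for c outside the finite images of infinity under G. *)
Lemma exists_fixed_low_degree : (N < #|K|)%N ->
  exists U V : {poly K}, [/\ V != 0, (size V < size U)%N, (size U <= N.+1)%N &
    inF G (tof U / tof V)].
Proof.
move=> N_lt; have [u u_ex] := fin_all_exists (fun i => is_aut_moebius _ _ (HG.1 i)).
have [v uvP] := fin_all_exists u_ex.
have v_neq0 i : v i != 0 by case: (uvP i).
(* The value of [G i x] at infinity if it is finite, and otherwise one more constant to avoid, which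
   is harmless. *)
pose bad i := (u i)`_(size (v i)).-1 / lead_coef (v i).
have [c c_good] : exists c, c \notin codom bad.
  apply/existsP; rewrite -negb_forall; apply: contraL N_lt => /forallP all_bad.
  rewrite -leqNgt -[X in (_ <= X)%N]card_ord -(size_codom bad) cardE.
  by apply: uniq_leq_size; rewrite ?enum_uniq // => c _; apply: all_bad.
pose w i := u i - c *: v i.
(* As [c] differs from [bad i], the coefficient of [w i] in degree deg v_i is nonzero. *)
have size_w i : (size (v i) <= size (w i))%N.
  have sv : (0 < size (v i))%N by rewrite size_poly_gt0.
  rewrite -(prednK sv) ltnNge; apply/negP=> /leq_sizeP/(_ _ (leqnn _))/eqP.
  rewrite coefB coefZ subr_eq0; apply/negP; apply: contra c_good => /eqP e; apply/codomP; exists i.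
  by rewrite /bad e mulfK ?lead_coef_eq0.
have w_neq0 i : w i != 0.
  by rewrite -size_poly_gt0 (leq_trans _ (size_w i)) ?size_poly_gt0.
have size_w2 i : (size (w i) <= 2)%N.
  have [_ su sv _] := uvP i.
  by rewrite (leq_trans (size_polyD _ _)) // geq_max su size_polyN (leq_trans (size_scale_leq _ _)).
(* The identity of the group contributes the factor x - c, whose pole at infinity makes the
   comparison of sizes strict. *)
have [i1 Gi1] := HG.2.2.1.
have size_w1 : (size (v i1) < size (w i1))%N.
  have [_ _ _ e] := uvP i1; rewrite Gi1 -[xE K]divr1 -(rmorph1 (@tof K)) in e.
  have /= := tof_div_eq _ _ _ _ _ (oner_neq0 _) (v_neq0 i1) e.
  rewrite mulr1 => uE; have size_u : size (u i1) = (size (v i1)).+1.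
    by rewrite -uE mulrC size_mulX.
  rewrite /w size_polyDl ?size_u // size_polyN ltnS.
  exact: size_scale_leq.
exists (\prod_i w i), (\prod_i v i).
have sum_lt : (\sum_i size (v i) < \sum_i size (w i))%N.
  rewrite (bigD1 i1) //= [X in (_ < X)%N](bigD1 i1) //=.
  by rewrite -addSn leq_add // leq_sum.
(* [size_prod] subtracts the number of factors with truncation; this bound lets the strict
   inequality survive it. *)
have sum_ge : (N <= \sum_i size (v i))%N.
  rewrite -[X in (X <= _)%N](card_ord N) -sum1_card leq_sum // => i _.
  by rewrite size_poly_gt0.
have sum_le : (\sum_i size (w i) <= N * 2)%N.
  by rewrite -[X in (X * 2)%N](card_ord N) -sum_nat_const leq_sum.
split.
- by apply/prodf_neq0.
- rewrite !size_prod // !card_ord; move: sum_lt sum_ge sum_le; clear.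
  by move: (\sum_i _)%N (\sum_i _)%N => a b; lia.
- rewrite !size_prod // !card_ord; move: sum_lt sum_ge sum_le; clear.
  by move: (\sum_i size (w i))%N => a; lia.
- suff -> : tof (\prod_i w i) / tof (\prod_i v i) = \prod_i G i (xE K - cst c).
    exact: inF_orbit_prod.
  rewrite !rmorph_prod -prodf_div; apply: eq_bigr => i _.
  have [s sE] := is_aut_rmorphism _ _ (HG.1 i).
  have -> : G i (xE K - cst c) = tof (u i) / tof (v i) - cst c.
    by have [_ _ _ <-] := uvP i; rewrite sE rmorphB -!sE (HG.1 i).2.2.2.2.
  rewrite /w rmorphB -mul_polyC rmorphM mulrBl mulfK ?tof_neq0 //.
Qed.

(* u^-m cancels the poles of g at every place over Q_oo at once, by
   [same_below]; this replaces the transitivity of G on these places. *)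
Lemma inL_numerator m g (U V : {poly K}) :
  V != 0 -> (size V < size U)%N -> inF G (tof U / tof V) -> inL G m g ->
  exists2 B : {poly K}, g * tof V ^+ m = tof B & (size B <= ((size U).-1 * m).+1)%N.
Proof.
move=> V_neq0 UV Fu [Fg [g_reg [e [[e_gt0 [_ e_dvd]] g_inf]]]].
have U_neq0 : U != 0 by rewrite -size_poly_gt0 (leq_ltn_trans _ UV).
have Um_neq0 : U ^+ m != 0 by rewrite expf_neq0.
have Vm_neq0 : V ^+ m != 0 by rewrite expf_neq0.
have size_gt0 (p : {poly K}) : p != 0 -> (0 < size p)%N by rewrite size_poly_gt0.
(* U / V lies in F and has a pole of order deg U - deg V > 0 at infinity, so [e] divides that
   order. *)
have e_le : (e <= size U - size V)%N.
  apply: dvdn_leq; first by rewrite subn_gt0.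
  have : veq PInf (- (size U - size V)%N%:Z) (tof U / tof V).
    split; first by right; exists U, V; split=> //; split=> //; lia.
    by case/(vgeInf_tof_div _ _ _ _ V_neq0) => [/eqP|]; [rewrite (negPf U_neq0) | lia].
  by move/(e_dvd _ _ Fu); rewrite dvdzE abszN /=.
pose y := tof (V ^+ m) / tof (U ^+ m).
have yE : y = (tof U / tof V)^-1 ^+ m by rewrite invf_div exprMn exprVn /y !rmorphXn.
have Fgy : inF G (g * y) by rewrite yE; apply/inF_mul/inF_exp/inF_inv.
(* At infinity [g] has a pole of order at most m e, and [y] a zero of order m (deg U - deg V), which
   is at least m e. *)
have gy_inf : vge PInf 0 (g * y).
  have [a [b [b_neq0 _ gE]]] := RFF_fractionP _ g; rewrite gE in g_inf *.
  case: (vgeInf_tof_div _ _ _ _ b_neq0 g_inf) => [-> | szab].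
    by left; rewrite rmorph0 !mul0r.
  have [-> | a_neq0] := eqVneq a 0; first by left; rewrite rmorph0 !mul0r.
  right; exists (a * V ^+ m), (b * U ^+ m); rewrite mulf_neq0 //; split=> //; split.
    by rewrite mulf_div !rmorphM.
  rewrite !size_mul //.
  have := size_exp U m; have := size_exp V m.
  have := size_gt0 _ Um_neq0; have := size_gt0 _ Vm_neq0.
  have := size_gt0 _ a_neq0; have := size_gt0 _ b_neq0.
  have := size_gt0 _ V_neq0; have := leq_mul e_le (leqnn m).
  move: UV szab; clear.
  move: (size a) (size b) (size U) (size V) (size (V ^+ m)) (size (U ^+ m)).
  nia.
have [B BE] : exists B, g * tof (V ^+ m) = tof B.
  apply: regular_is_poly => R R_place R_neq.
  have reg_tof p : vge R 0 (tof p).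
    case: R R_place R_neq => // pi [_ pi_irr] _; right; exists p, 1.
    rewrite oppr0 expr0z mulr1 rmorph1 divr1; split=> //.
    by rewrite dvdp1 gtn_eqF // pi_irr.1.
  have mul_reg h h' : vge R 0 h -> vge R 0 h' -> vge R 0 (h * h').
    case: R R_place R_neq { reg_tof} => // pi [_ pi_irr] _.
    case/vge_PFin0 => [-> _|[a [b [pi_b ->]]]]; first by left; rewrite mul0r.
    case/vge_PFin0 => [->|[a' [b' [pi_b' ->]]]]; first by left; rewrite mulr0.
    right; exists (a * a'), (b * b'); rewrite oppr0 expr0z mulr1 mulf_div !rmorphM.
    by split=> //; rewrite Gauss_dvdpr ?irreducible_poly_coprime.
  have [R_inf | R_ninf] := classic (same_below G R PInf); last first.
    by apply: mul_reg => //; apply: g_reg.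
  have -> : g * tof (V ^+ m) = g * y * tof (U ^+ m).
    by rewrite /y -!mulrA mulVf ?tof_neq0 // mulr1.
  by apply: mul_reg => //; apply/R_inf.
exists B; first by rewrite -rmorphXn.
(* As g y = B / U^m is regular at infinity, deg B is at most m deg U. *)
have [-> | B_neq0] := eqVneq B 0; first by rewrite size_poly0.
move: gy_inf; rewrite mulrA BE => /(vgeInf_tof_div _ _ _ _ Um_neq0)[/eqP|].
  by rewrite (negPf B_neq0).
have := size_exp U m; have := size_gt0 _ Um_neq0; clear.
move: (size B) (size (U ^+ m)) ((size U).-1 * m)%N; lia.
Qed.

(** Over the common denominator [V ^+ m] the numerator has degree at most [N * m], fewer than its
    roots. *)
Lemma inL_sum_eq0 m t (f : 'I_t -> RFF K) (c : 'I_t -> K) (rs : seq K) :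
  (N < #|K|)%N -> (forall j, inL G m (f j)) ->
  uniq rs -> (N * m < size rs)%N ->
  (forall a, a \in rs -> has_value K a (\sum_j cst (c j) * f j) 0) ->
  \sum_j cst (c j) * f j = 0.
Proof.
move=> N_lt Lf rs_uniq rs_size val0.
have [U [V [V_neq0 UV U_N Fu]]] := exists_fixed_low_degree N_lt.
have [B BE B_size] := fin_all_exists2 (fun j => inL_numerator _ _ _ _ V_neq0 UV Fu (Lf j)).
pose S := \sum_j c j *: B j.
have SE : (\sum_j cst (c j) * f j) * tof (V ^+ m) = tof S.
  rewrite mulr_suml rmorph_sum; apply: eq_bigr => j _.
  by rewrite -mulrA rmorphXn BE -mul_polyC rmorphM.
have Vm_neq0 : tof (V ^+ m) != 0 by rewrite tof_neq0 ?expf_neq0.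
suff S0 : S = 0.
  apply/eqP; rewrite S0 rmorph0 in SE.
  by move/eqP: SE; rewrite mulf_eq0 (negPf Vm_neq0) orbF.
apply: (roots_geq_poly_eq0 _ rs_uniq).
  apply/allP=> a /val0 val_a; rewrite rootE; apply/eqP.
  have := has_value_mul _ _ _ _ _ _ val_a (has_value_tof _ a (V ^+ m)).
  by rewrite SE mul0r; apply: has_value_inj; apply: has_value_tof.
apply: (leq_trans (size_sum _ _ _)); apply/bigmax_leqP => j _.
rewrite (leq_trans (size_scale_leq _ _)) // (leq_trans (B_size j)) //.
apply: leq_ltn_trans rs_size; rewrite leq_mul2r; apply/orP; right.
by move: U_N; case: (size U).
Qed.

End FixedField.

(** * Doubly extended Reed-Solomon blocks *)

(** If the coefficient of degree r - 1 is nonzero, it adds 1 to at least two nonroots among r + 1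
    points; if it is zero, the degree drops and there are at least three nonroots. *)
Lemma size3_nonroots (K : fieldType) r (g : {poly K}) (a : 'I_r.+1 -> K) :
  injective a -> g != 0 -> (size g <= r)%N ->
  (3 <= #|[set h | (g.[a h] != 0)%R]| + (g`_r.-1 != 0)%R)%N.
Proof.
move=> a_inj g_neq0 g_r.
have roots_lt : (#|[set h | (g.[a h] == 0)%R]| < size g)%N.
  rewrite cardE -(size_map a); apply: max_poly_roots => //.
    by apply/allP=> y /mapP[h]; rewrite mem_enum inE => g0 ->.
  by rewrite map_inj_uniq ?enum_uniq.
have roots_sum : (#|[set h | (g.[a h] == 0)%R]| + #|[set h | (g.[a h] != 0)%R]| = r.+1)%N.
  rewrite -[RHS](card_ord r.+1) -[RHS](cardsC [set h | (g.[a h] == 0)%R]).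
  by congr (_ + #|pred_of_set _|)%N; apply/setP=> h; rewrite !inE.
have g_gt0 : (0 < size g)%N by rewrite size_poly_gt0.
have [g_lead | ] := eqVneq; last by rewrite addn1; lia.
suff size_le : (size g <= r.-1)%N by rewrite addn0; lia.
rewrite leqNgt; apply/negP=> lt_r; move: g_neq0; rewrite -lead_coef_eq0 lead_coefE.
suff -> : (size g).-1 = r.-1 by rewrite g_lead eqxx.
by move: g_r lt_r; case: (size g) => [|n]; lia.
Qed.

(** For t = s the evaluation matrix is square with trivial kernel, so it is invertible. The solution
    serves to build a codeword supported on block 0 only. *)
Lemma exists_dual_vector (K : fieldType) s t (phi : nat -> nat -> K) :
  t = s -> (0 < s)%N ->
  (forall c : 'I_t -> K, (forall i, (i < s)%N -> \sum_j c j * phi j i = 0) ->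
     forall j, c j = 0) ->
  exists b : 'I_t -> K,
    forall i, (i < s)%N -> \sum_j b j * phi j i = (i == 0%N)%:R.
Proof.
move=> -> {t}; case: s => // s _ phi_inj.
pose M := \matrix_(j < s.+1, i < s.+1) phi j i.
have M_unit : M \in unitmx.
  rewrite -row_free_unit; apply: inj_row_free => v vM0.
  apply/rowP=> j; rewrite mxE; apply: (phi_inj (v 0)) => i lt_i.
  have /rowP/(_ (Ordinal lt_i)) := vM0; rewrite !mxE => e.
  by rewrite -[RHS]e; apply: eq_bigr => l _; rewrite mxE.
pose b : 'rV_s.+1 := delta_mx 0 0 *m invmx M.
exists (b 0) => i lt_i.
have /rowP/(_ (Ordinal lt_i)) : b *m M = delta_mx 0 0 by rewrite mulmxKV.
rewrite !mxE eqxx -val_eqE /= => e; rewrite -[RHS]e.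
by apply: eq_bigr => l _; rewrite [M _ _]mxE.
Qed.

(** * The code built from s blocks, its locality and its minimum distance *)

Section BlockCode.
Variables (K : finFieldType) (r s t : nat).
Variables (alpha phi : nat -> nat -> K).
Hypothesis r_gt0 : (0 < r)%N.
Hypothesis alpha_inj : forall i h h',
  (i < s)%N -> (h < r.+1)%N -> (h' < r.+1)%N -> alpha i h = alpha i h' -> h = h'.
Hypothesis phi_inj : forall c : 'I_t -> K,
  (forall i, (i < s)%N -> \sum_j c j * phi j i = 0) -> forall j, c j = 0.
Implicit Type A : 'M[K]_(r, t).

(** With [alpha i h] standing for z(P_{i,h}) and [phi j i] for f_j(Q_i), this is the polynomial in z
    that f_A becomes above Q_i. *)
Definition msg A i : {poly K} := \sum_l (\sum_j A l j * phi j i) *: 'X^l.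

Definition symbol A k : K :=
  if (k < s * r.+1)%N then (msg A (k %/ r.+1)).[alpha (k %/ r.+1) (k %% r.+1)]
  else (msg A (k - s * r.+1))`_r.-1.

Definition word A : 'rV[K]_(s * (r + 2)) := \row_k symbol A k.

Definition block_code : {set 'rV[K]_(s * (r + 2))} := [set word A | A : 'M[K]_(r, t)].

Lemma coef_msg A i (l : 'I_r) : (msg A i)`_l = \sum_j A l j * phi j i.
Proof.
rewrite coef_sum (bigD1 l) //= coefZ coefXn eqxx mulr1 [X in _ + X]big1 ?addr0 // => l' neq_l.
by rewrite coefZ coefXn eq_sym (negPf (neq_l : val l' != val l)) mulr0.
Qed.

Lemma size_msg A i : (size (msg A i) <= r)%N.
Proof.
apply: (leq_trans (size_sum _ _ _)); apply/bigmax_leqP => l _.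
by rewrite (leq_trans (size_scale_leq _ _)) // size_polyXn.
Qed.

Lemma msg_linear c A B i : msg (c *: A + B) i = c *: msg A i + msg B i.
Proof.
rewrite /msg scaler_sumr -big_split; apply: eq_bigr => l _ /=.
rewrite scalerA -scalerDl mulr_sumr -big_split; congr (_ *: _).
by apply: eq_bigr => j _; rewrite !mxE mulrDl mulrA.
Qed.

Lemma word_is_linear : linear word.
Proof.
move=> c A B; apply/rowP=> k; rewrite !mxE /symbol !msg_linear.
by case: ifP => _; rewrite ?hornerE // coefD coefZ.
Qed.

HB.instance Definition _ :=
  GRing.isLinear.Build K 'M[K]_(r, t) 'rV[K]_(s * (r + 2)) *:%R word word_is_linear.

(** Symbols 0..r of block [i] are its evaluations; symbol r + 1 is its coefficient symbol, stored
    after all s (r + 1) evaluations. *)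
Definition pos i h : nat := if (h < r.+1)%N then (i * r.+1 + h)%N else (s * r.+1 + i)%N.

Lemma pos_lt (i : 'I_s) h : (pos i h < s * (r + 2))%N.
Proof.
have lt_i := ltn_ord i; rewrite /pos; case: (ltnP h r.+1) => lt_h; last by lia.
have := leq_mul lt_i (leqnn r.+1); lia.
Qed.

Definition pos_ord (i : 'I_s) (h : 'I_r.+2) := Ordinal (pos_lt i h).

Lemma pos_ord_inj i : injective (pos_ord i).
Proof.
move=> h h' /(congr1 val) /=; rewrite /pos => e; apply: val_inj => /=; move: e.
have := ltn_ord h; have := ltn_ord h'; have := leq_mul (ltn_ord i) (leqnn r.+1).
by case: (ltnP h r.+1) => ?; case: (ltnP h' r.+1) => ?; lia.
Qed.

Lemma pos_ord_surj (k : 'I_(s * (r + 2))) : exists i h, k = pos_ord i h.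
Proof.
have lt_k := ltn_ord k; have [k_lt | k_ge] := ltnP k (s * r.+1).
  have lt_i : (k %/ r.+1 < s)%N by rewrite ltn_divLR.
  have lt_h : (k %% r.+1 < r.+1)%N by rewrite ltn_mod.
  exists (Ordinal lt_i), (Ordinal (ltnW lt_h : (_ < r.+2)%N)); apply: val_inj => /=.
  by rewrite /pos lt_h -divn_eq.
have lt_i : (k - s * r.+1 < s)%N by lia.
exists (Ordinal lt_i), ord_max; apply: val_inj => /=.
by rewrite /pos ltnn subnKC.
Qed.

Lemma word_pos A (i : 'I_s) (h : 'I_r.+2) : word A ord0 (pos_ord i h) =
  if (h < r.+1)%N then (msg A i).[alpha i h] else (msg A i)`_r.-1.
Proof.
rewrite mxE /symbol /= /pos; case: (ltnP h r.+1) => lt_h.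
  have -> : (i * r.+1 + h < s * r.+1)%N.
    have := leq_mul (ltn_ord i) (leqnn r.+1); lia.
  by rewrite divnMDl // modnMDl divn_small // modn_small // addn0.
by rewrite ltnNge leq_addr /= addKn.
Qed.

Lemma word_block_weight A (i : 'I_s) : msg A i != 0 ->
  (3 <= #|[set h | word A ord0 (pos_ord i h) != 0%R]|)%N.
Proof.
move=> msg_neq0.
have a_inj : injective (fun h : 'I_r.+1 => alpha i h).
  by move=> h h' /alpha_inj e; apply: val_inj; apply: e.
apply: (leq_trans (size3_nonroots _ _ _ _ a_inj msg_neq0 (size_msg A i))).
rewrite -!sum1_card big_mkcond [X in (_ <= X)%N]big_mkcond /=.
rewrite [X in (_ <= X)%N]big_ord_recr /=.
rewrite leq_add //; last by rewrite inE word_pos /= ltnn; case: eqP.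
apply: leq_sum => h _; rewrite !inE word_pos /=.
by rewrite ltn_ord.
Qed.

Lemma word_neq0_msg A (i : 'I_s) (h : 'I_r.+2) : word A ord0 (pos_ord i h) != 0 -> msg A i != 0.
Proof.
rewrite word_pos; apply: contraNneq => ->.
by rewrite horner0 coef0 if_same.
Qed.

Lemma word_eq0_msg A (i : 'I_s) : word A = 0 -> msg A i = 0.
Proof.
move=> wA0; apply/eqP; apply: contraT => /word_block_weight.
by rewrite wA0 (_ : [set h | _] = set0) ?cards0 //; apply/setP=> h; rewrite !inE mxE eqxx.
Qed.

(** A zero word has zero block polynomials by the weight bound; their coefficients pair the rows of
    A with [phi], so [phi_inj] kills every row. *)
Lemma word_inj : injective word.
Proof.
apply: raddf_inj => A wA0; apply/matrixP=> l j; rewrite mxE.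
apply: (phi_inj (A l)) => i lt_i.
by rewrite -coef_msg (word_eq0_msg _ (Ordinal lt_i) wA0) coef0.
Qed.

Lemma block_code_linear : is_lincode block_code.
Proof.
split; first by apply/imsetP; exists 0; rewrite ?raddf0.
move=> _ _ c /imsetP[A _ ->] /imsetP[B _ ->].
by apply/imsetP; exists (c *: A + B); rewrite ?linearP.
Qed.

Lemma block_code_dim : code_dim block_code = (r * t)%N.
Proof.
rewrite /code_dim (_ : <<_>>%VS = limg (linfun word)).
  rewrite limg_dim_eq; first by rewrite dimvf dim_matrix.
  suff /eqP -> : lker (linfun word) == 0%VS by rewrite capv0.
  by apply/lker0P=> A B; rewrite !lfunE; apply: word_inj.
apply/eqP; rewrite eqEsubv; apply/andP; split.
  apply/span_subvP=> c; rewrite mem_enum => /imsetP[A _ ->].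
  by rewrite -[word A]lfunE memv_img ?memvf.
apply/subvP=> _ /memv_imgP[A _ ->]; rewrite lfunE /=.
by apply: memv_span; rewrite mem_enum imset_f.
Qed.

Lemma block_weight_ge A (i : 'I_s) (h : 'I_r.+2) : word A ord0 (pos_ord i h) != 0 ->
  (3 <= #|[set k in [set pos_ord i h | h in 'I_r.+2] | word A ord0 k != 0%R]|)%N.
Proof.
move=> /word_neq0_msg/word_block_weight w3; apply: (leq_trans w3).
rewrite -(card_imset _ (pos_ord_inj i)); apply: subset_leq_card.
apply/subsetP=> _ /imsetP[h' h'_neq0 ->]; rewrite inE in h'_neq0.
by rewrite !inE imset_f.
Qed.

(** The recovery set is the whole block, of r + 2 = r + 3 - 1 positions. *)
Lemma block_code_LRC : is_LRC block_code r 3.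
Proof.
move=> k; have [i [h ->]] := pos_ord_surj k.
exists [set pos_ord i h | h in 'I_r.+2]; split; first exact: imset_f.
split; first by rewrite (leq_trans (leq_imset_card _ _)) // card_ord; lia.
move=> _ /imsetP[A _ ->] /existsP[_ /andP[/imsetP[h' _ ->]]].
exact: block_weight_ge.
Qed.

Lemma block_code_weight c : c \in block_code -> c != 0 -> (3 <= wt c)%N.
Proof.
move=> /imsetP[A _ ->] wA_neq0.
have [k wAk] : exists k, word A ord0 k != 0.
  apply/existsP; apply: contraR wA_neq0; rewrite negb_exists => /forallP wA0.
  by apply/eqP/rowP=> k; rewrite [RHS]mxE; apply/eqP; have := wA0 k; rewrite negbK.
have [i [h kE]] := pos_ord_surj k; rewrite kE in wAk.
apply: (leq_trans (block_weight_ge _ _ _ wAk)); apply: subset_leq_card.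
by apply/subsetP=> l; rewrite !inE => /andP[].
Qed.

Lemma block_code_min_dist (b : 'I_t -> K) : (0 < s)%N ->
  (forall i, (i < s)%N -> \sum_j b j * phi j i = (i == 0%N)%:R) ->
  min_dist block_code 3.
Proof.
move=> s_gt0 b_dual; split; last exact: block_code_weight.
pose i0 := Ordinal s_gt0.
(* Monic of degree r - 1 and zero at the first r - 1 points of block 0: only two evaluations and the
   leading coefficient can be nonzero. *)
pose g : {poly K} := \prod_(l <- iota 0 r.-1) ('X - (alpha 0 l)%:P).
have g_size : size g = r by rewrite size_prod_XsubC size_iota prednK.
(* The outer product with [b] puts [g] into block 0 and zero into all other blocks. *)
pose A : 'M[K]_(r, t) := \matrix_(l, j) (g`_l * b j).
have msgA i : (i < s)%N -> msg A i = (i == 0%N)%:R *: g.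
  move=> lt_i; rewrite -[g in RHS]coefK g_size poly_def scaler_sumr.
  apply: eq_bigr => l _; rewrite scalerA; congr (_ *: _).
  under eq_bigr => j _ do rewrite mxE -mulrA.
  by rewrite -mulr_sumr b_dual // mulrC.
have wA_neq0 : word A != 0.
  apply/eqP=> /(word_eq0_msg _ i0)/eqP; rewrite msgA // eqxx scale1r.
  by rewrite -size_poly_eq0 g_size eqn0Ngt r_gt0.
have wA_in : word A \in block_code by rewrite imset_f.
exists (word A) => //; split=> //; apply/eqP.
rewrite eqn_leq (block_code_weight _ wA_in wA_neq0) andbT.
have lt1 : (r.-1 < r.+2)%N by lia.
have lt2 : (r < r.+2)%N by lia.
pose S := [:: pos_ord i0 (Ordinal lt1); pos_ord i0 (Ordinal lt2); pos_ord i0 ord_max].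
apply: (leq_trans _ (card_size S)); apply/subset_leq_card/subsetP => k.
have [i [h ->]] := pos_ord_surj k; rewrite inE word_pos.
have [i_eq0 | i_neq0] := eqVneq (i : nat) 0%N; last first.
  by rewrite msgA ?ltn_ord // (negPf i_neq0) scale0r horner0 coef0 if_same eqxx.
have -> : i = i0 by apply: val_inj.
rewrite msgA // eqxx scale1r /S !inE !(inj_eq (pos_ord_inj i0)) -!val_eqE /=.
have := ltn_ord h; case: (ltnP h r.-1) => [lt_h | ge_h] lt_h2 gh; last first.
  by move: r_gt0; lia.
move: gh; rewrite (ltn_trans lt_h); last by move: r_gt0; lia.
rewrite horner_prod (bigD1_seq (h : nat)) ?iota_uniq ?mem_iota //=.
by rewrite hornerXsubC subrr mul0r eqxx.
Qed.

End BlockCode.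

Lemma optimal_bound_mul r s : (0 < r)%N -> (0 < s)%N ->
  optimal_bound (s * (r + 2)) (r * s) r 3 = 3.
Proof.
move=> r_gt0 s_gt0; rewrite /optimal_bound.
have -> : ((r * s + r - 1) %/ r = s)%N.
  by rewrite -addnBA // [(r * s)%N]mulnC divnMDl // divn_small ?addn0 // subn1 prednK.
lia.
Qed.

(** * The code of the theorem *)

(** [same_below] compares regularity only. If g had value c at a but not at b, then 1 / (g - c), an
    element of F, would be regular at b and not at a. *)
Lemma same_below_value (K : finFieldType) N (G : 'I_N -> RFF K -> RFF K)
    (HG : is_aut_subgroup G) (a b : K) (g : RFF K) (c : K) :
  same_below G (PFin ('X - a%:P)) (PFin ('X - b%:P)) -> inF G g ->
  has_value K a g c -> has_value K b g c.
Proof.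
move=> ab Fg gac.
have [d gbd] : exists d, has_value K b g d.
  by apply/vge0_has_value/ab => //; apply: has_value_vge0 gac.
have [<-//|d_neq_c] := eqVneq d c.
pose k := g - cst c; have Fk : inF G k by apply: inF_sub_cst.
have value_k x y : has_value K x g y -> has_value K x k (y - c).
  move=> gxy; apply: has_value_add => //; rewrite /cst -rmorphN -polyCN.
  exact: has_value_cst.
have kb := value_k _ _ gbd; have dc_neq0 : d - c != 0 by rewrite subr_eq0.
have [e ke] : exists e, has_value K a k^-1 e.
  apply/vge0_has_value/ab; first exact: inF_inv.
  exact: has_value_vge0 (has_value_inv _ _ _ _ dc_neq0 kb).
have k_neq0 : k != 0.
  apply: contraNneq dc_neq0 => k0; apply/eqP.
  apply: has_value_inj kb _; rewrite k0 -(rmorph0 (@tof K)) -polyC0.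
  exact: has_value_cst.
have := has_value_mul _ _ _ _ _ _ (value_k _ _ gac) ke.
rewrite mulfV // subrr mul0r -(rmorph1 (@tof K)) -polyC1 => k1.
have /eqP := has_value_inj _ _ _ _ _ (has_value_cst K a 1) k1.
by rewrite oner_eq0.
Qed.

Lemma horner_size2_inj (K : fieldType) (g : {poly K}) :
  size g = 2 -> injective (horner g).
Proof.
move=> g2 x y; rewrite !horner_coef g2 !big_ord_recl !big_ord0 /= => /addrI.
have g1_neq0 : g`_1 != 0.
  by have := lead_coefE g; rewrite g2 => <-; rewrite lead_coef_eq0 -size_poly_eq0 g2.
by rewrite !addr0 !expr1; apply: mulfI.
Qed.

Theorem mainTheorem3
  (K : finFieldType) (p q : nat)
  (Hp : prime p) (Hq : exists m, (0 < m)%N /\ q = (p ^ m)%N) (HK : #|K| = q)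
  (r : nat) (Hr : (1 <= r)%N)
  (Hcond : (exists v, r = (p ^ v - 1)%N) \/ (r.+1 %| q.-1)%N \/
           (exists u v, [/\ (0 < u)%N, (0 < v)%N & r.+1 = (u * p ^ v)%N]))
  (G : 'I_r.+1 -> RFF K -> RFF K) (HG : is_aut_subgroup G)
  (z : RFF K)
  (Hz : veq PInf (-1) z /\ (forall R, is_place R -> R <> PInf -> vge R 0 z))
  (s : nat) (Hs : (2 <= s)%N /\ (s * r.+1 + 2 * r <= q + 1)%N)
  (P : nat -> nat -> place K)
  (HPplace : forall i h, (i < s)%N -> (h < r.+1)%N ->
      [/\ is_place (P i h), rational_place (P i h),
          is_ramidx G (P i h) 1 & same_below G (P i h) (P i 0%N)])
  (HPall : forall i R, (i < s)%N -> is_place R -> same_below G R (P i 0%N) ->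
      exists2 h, (h < r.+1)%N & R = P i h)
  (HPdist : forall i h h', (i < s)%N -> (h < r.+1)%N -> (h' < r.+1)%N ->
      P i h = P i h' -> h = h')
  (HQrat : forall i, (i < s)%N -> rational_below G (P i 0%N))
  (HQinf : forall i, (i < s)%N -> ~ same_below G (P i 0%N) PInf)
  (HQdist : forall i j, (i < s)%N -> (j < s)%N ->
      same_below G (P i 0%N) (P j 0%N) -> i = j)
  (t : nat) (Ht : (1 <= t <= s)%N)
  (f : nat -> RFF K)
  (HfL : forall j, (j < t)%N -> inL G t.-1 (f j))
  (Hfind : forall c : nat -> K,
      \sum_(j < t) cst (c j) * f j = 0 -> forall j, (j < t)%N -> c j = 0)
  (Hfspan : forall g, inL G t.-1 g ->
      exists c : nat -> K, g = \sum_(j < t) cst (c j) * f j) :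
  let C := Ce r s t z f P in
  [/\ is_lincode C, code_dim C = (r * t)%N, is_LRC C r 3 &
      (t = s -> min_dist C (optimal_bound (s * (r + 2)) (r * t) r 3) /\
                min_dist C (s * (r + 2) - r * t - 2 * t + 3)%N)].
Proof.
have [s_ge2 s_le] := Hs; have /andP[t_gt0 t_le_s] := Ht.
have [gz [zE gz2]] := linear_of_pole_divisor _ _ Hz.1 Hz.2.
(* The root of the linear polynomial defining P_{i,h}; the default 0 for [PInf] is never reached for
   indices in range. *)
pose c i h := if P i h is PFin pi then - pi`_0 else 0.
have PE i h : (i < s)%N -> (h < r.+1)%N -> P i h = PFin ('X - (c i h)%:P).
  move=> lt_i lt_h; have [_ Prat _ Pbelow] := HPplace i h lt_i lt_h.
  rewrite /c; case: Prat => [Pinf | [a ->]]; last first.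
    by rewrite coefB coefX coefC /= sub0r opprK.
  (* If P_{i,h} were P_oo, then Q_i would be Q_oo. *)
  by case: (HQinf i lt_i) => g Fg; rewrite Pinf in Pbelow; case: (Pbelow g Fg).
have same_below_c i h : (i < s)%N -> (h < r.+1)%N ->
    same_below G (PFin ('X - (c i 0%N)%:P)) (PFin ('X - (c i h)%:P)).
  move=> lt_i lt_h g Fg; rewrite -!PE //.
  by have [_ _ _ /(_ g Fg)[]] := HPplace i h lt_i lt_h; split.
have c_inj i h i' h' : (i < s)%N -> (h < r.+1)%N -> (i' < s)%N -> (h' < r.+1)%N ->
    c i h = c i' h' -> i = i' /\ h = h'.
  move=> lt_i lt_h lt_i' lt_h' c_eq.
  have P_eq : P i h = P i' h' by rewrite !PE // c_eq.
  suff i_eq : i = i' by split=> //; apply: (HPdist i) => //; rewrite P_eq i_eq.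
  apply: HQdist => // g Fg; have [_ _ _ /(_ g Fg)[e1 e2]] := HPplace i h lt_i lt_h.
  have [_ _ _ /(_ g Fg)[e3 e4]] := HPplace i' h' lt_i' lt_h'.
  by rewrite P_eq in e1 e2; split; auto.
pose phi j i := ev (P i 0%N) (f j).
have f_value i h j : (i < s)%N -> (h < r.+1)%N -> (j < t)%N ->
    has_value K (c i h) (f j) (phi j i).
  move=> lt_i lt_h lt_j; have [Ff [f_reg _]] := HfL j lt_j.
  apply: (same_below_value _ _ _ HG _ _ _ _ (same_below_c i h lt_i lt_h) Ff).
  have [b fb] : exists b, has_value K (c i 0%N) (f j) b.
    apply: vge0_has_value; rewrite -PE //; apply: f_reg; last exact: HQinf.
    by have [] := HPplace i 0%N lt_i (ltn0Sn _).
  by rewrite /phi PE // (ev_has_value _ _ _ _ fb).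
pose alpha i h := gz.[c i h].
have alpha_inj i h h' : (i < s)%N -> (h < r.+1)%N -> (h' < r.+1)%N ->
    alpha i h = alpha i h' -> h = h'.
  move=> lt_i lt_h lt_h' /(horner_size2_inj _ _ gz2) c_eq.
  by case: (c_inj i h i h').
have phi_inj (d : 'I_t -> K) :
    (forall i, (i < s)%N -> \sum_j d j * phi j i = 0) -> forall j, d j = 0.
  (* [Hfind] takes coefficients indexed by [nat], so [d] is extended by 0. *)
  move=> d0 j; pose d' n := oapp d 0 (insub n : option 'I_t).
  have d'E (l : 'I_t) : d' l = d l by rewrite /d' valK.
  rewrite -d'E; apply: Hfind (ltn_ord j); under eq_bigr => l _ do rewrite d'E.
  (* All s (r + 1) points above the Q_i; they outnumber (r + 1) (t - 1) because t - 1 < s. *)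
  pose rs := [seq c (k %/ r.+1)%N (k %% r.+1)%N | k <- iota 0 (s * r.+1)].
  apply: (inL_sum_eq0 _ _ _ HG t.-1 _ (fun l : 'I_t => f l) d rs).
  (* From s >= 2 one gets q >= 4 r + 1 > r + 1. *)
  - by rewrite HK; lia.
  - by move=> l; apply: HfL.
  - rewrite map_inj_in_uniq ?iota_uniq // => k k'; rewrite !mem_iota /= => lt_k lt_k' c_eq.
    case: (c_inj _ _ _ _ _ _ _ _ c_eq); rewrite ?ltn_mod ?ltn_divLR // => e1 e2.
    by rewrite (divn_eq k r.+1) (divn_eq k' r.+1) e1 e2.
  - rewrite size_map size_iota mulnC ltn_pmul2r //; lia.
  - move=> _ /mapP[k k_lt ->]; rewrite mem_iota /= in k_lt.
    have lt_i : (k %/ r.+1 < s)%N by rewrite ltn_divLR.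
    rewrite -(d0 _ lt_i); apply: has_value_sum => l.
    by apply: has_value_mul; [apply: has_value_cst | apply: f_value; rewrite ?ltn_mod].
have encE A k : (k < s * (r + 2))%N -> enc s z f P A k = symbol K r s t alpha phi A k.
  move=> lt_k; rewrite /enc /symbol; case: ltnP => k_s; last first.
    have lt_r : (r.-1 < r)%N by rewrite prednK.
    rewrite -[r.-1 in RHS]/(val (Ordinal lt_r)) coef_msg; apply: eq_bigr => j _.
    by rewrite /lastrow (big_pred1 (Ordinal lt_r)).
  have lt_i : (k %/ r.+1 < s)%N by rewrite ltn_divLR.
  have lt_h : (k %% r.+1 < r.+1)%N by rewrite ltn_mod.
  rewrite PE //; apply: ev_has_value; rewrite /fa /msg horner_sum.
  apply: has_value_sum => l; rewrite hornerZ hornerXn mulr_suml.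
  apply: has_value_sum => j; apply: has_value_mul.
    by apply: has_value_mul; [apply: has_value_cst | apply: f_value].
  by apply: has_value_exp; rewrite zE; apply: has_value_tof.
move=> C; have -> : C = block_code K r s t alpha phi.
  by apply: eq_imset => A; apply/rowP=> k; rewrite !mxE encE.
split.
- exact: block_code_linear.
- exact: block_code_dim.
- exact: block_code_LRC.
move=> t_s; have s_gt0 : (0 < s)%N by apply: ltnW.
have [b b_dual] := exists_dual_vector _ _ _ _ t_s s_gt0 phi_inj.
have d3 := block_code_min_dist K r s t alpha phi Hr alpha_inj b s_gt0 b_dual.
have -> : (s * (r + 2) - r * t - 2 * t + 3 = 3)%N by rewrite t_s; clear; lia.
by rewrite {2}t_s optimal_bound_mul.
Qed.
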